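(* Let $S\subseteq\mathbb{N}^2$ be a good semigroup and let $(\Gamma_S,\oplus,\odot)$ be its associated semiring. Then $\Gamma_S$ is generated as a semiring by the set $I_A(S)$ of its irreducible absolute elements; that is, every $\boldsymbol{\alpha}\in\Gamma_S\setminus\{\boldsymbol{0}\}$ can be written as a finite tropical sum of finite tropical products $$\boldsymbol{\alpha}=\bigoplus_{i=1}^{m}\Big(\bigodot_{j=1}^{n_i}\boldsymbol{\gamma}_{i,j}\Big),\qquad m\ge 1,\ n_i\geq 1,\ \boldsymbol{\gamma}_{i,j}\in I_A(S).$$
   Context: $\mathbb{N}=\{0,1,2,\dots\}$. A submonoid $S$ of $(\mathbb{N}^2,+)$ is a good semigroup if: (G1) $\boldsymbol{\alpha},\boldsymbol{\beta}\in S$ implies $\min(\boldsymbol{\alpha},\boldsymbol{\beta})=(\min\{\alpha_1,\beta_1\},\min\{\alpha_2,\beta_2\})\in S$; (G2) there is $\boldsymbol{\delta}\in\mathbb{N}^2$ with $\boldsymbol{\delta}+\mathbb{N}^2\subseteq S$; (G3) if $\boldsymbol{\alpha},\boldsymbol{\beta}\in S$, $\boldsymbol{\alpha}\ne\boldsymbol{\beta}$ and $\alpha_i=\beta_i$ for some $i$, then there is $\boldsymbol{\epsilon}\in S$ with $\epsilon_i>\alpha_i=\beta_i$ and $\epsilon_j\ge\min\{\alpha_j,\beta_j\}$ for $j\neq i$, with equality if $\alpha_j\ne\beta_j$. Good semigroups are always assumed local: if $\boldsymbol{\alpha}\in S$ has a zero coordinate, then $\boldsymbol{\alpha}=\boldsymbol{0}$.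 Let $\overline{\mathbb{N}}=\mathbb{N}\cup\{\infty\}$ with $a<\infty$ for $a\in\mathbb{N}$ and $x+\infty=\infty+x=\infty$ for all $x$. Put $S_1^\infty=\{(a,\infty): a\in\mathbb{N},\ \exists\,\tilde y\in\mathbb{N}\ \forall y\ge\tilde y,\ (a,y)\in S\}$, $S_2^\infty=\{(\infty,b): b\in\mathbb{N},\ \exists\,\tilde x\in\mathbb{N}\ \forall x\ge\tilde x,\ (x,b)\in S\}$, $S^\infty=S_1^\infty\cup S_2^\infty\cup\{(\infty,\infty)\}$ and $\Gamma_S=S\cup S^\infty\subseteq\overline{\mathbb{N}}^2$. On $\Gamma_S$ the tropical operations are $\boldsymbol{\alpha}\oplus\boldsymbol{\beta}=\min\{\boldsymbol{\alpha},\boldsymbol{\beta}\}$ (componentwise minimum) and $\boldsymbol{\alpha}\odot\boldsymbol{\beta}=\boldsymbol{\alpha}+\boldsymbol{\beta}$. An element $\boldsymbol{\alpha}\in\Gamma_S\setminus\{\boldsymbol{0}\}$ is irreducible if $\boldsymbol{\alpha}=\boldsymbol{\beta}+\boldsymbol{\gamma}$ with $\boldsymbol{\beta},\boldsymbol{\gamma}\in\Gamma_S$ implies $\boldsymbol{\alpha}=\boldsymbol{\beta}$ or $\boldsymbol{\alpha}=\boldsymbol{\gamma}$. An element $\boldsymbol{\alpha}\in\Gamma_S$ is absolute if either $\boldsymbol{\alpha}\in S^\infty$, or $\boldsymbol{\alpha}\in S$ and there is no $\boldsymbol{\beta}\in S$ with ($\beta_1=\alpha_1$ and $\beta_2>\alpha_2$)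 or ($\beta_2=\alpha_2$ and $\beta_1>\alpha_1$). $I_A(S)$ is the set of elements of $\Gamma_S$ that are both irreducible and absolute. *)

(* Defs.v *)
(* MathComp, with classical_sets for Prop-valued sets. *)
From HB Require Import structures.
From mathcomp Require Import all_boot classical_sets.

Set Implicit Arguments.
Unset Strict Implicit.
Unset Printing Implicit Defensive.

Local Open Scope classical_set_scope.

Definition pointwise (T : Type) (op : T -> T -> T) (a b : T * T) : T * T :=
  (op a.1 b.1, op a.2 b.2).

(* Coordinate 1 is [coord false], coordinate 2 is [coord true], so that
   [~~ i] is the index different from [i]. *)
Definition coord (T : Type) (i : bool) (a : T * T) : T :=
  if i then a.2 else a.1.

Record good_semigroup (S : set (nat * nat)) : Prop := GoodSemigroup {
  good_zero : S (0, 0);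
  good_add : forall a b, S a -> S b -> S (pointwise addn a b);
  good_min : forall a b, S a -> S b -> S (pointwise minn a b);
  good_conductor : exists d, forall a, S (pointwise addn d a);
  good_exchange : forall a b (i : bool),
    S a -> S b -> a <> b -> coord i a = coord i b ->
    exists e, [/\ S e,
      coord i a < coord i e,
      minn (coord (~~ i) a) (coord (~~ i) b) <= coord (~~ i) e &
      coord (~~ i) a <> coord (~~ i) b ->
        coord (~~ i) e = minn (coord (~~ i) a) (coord (~~ i) b)] }.

Definition local (S : set (nat * nat)) : Prop :=
  forall a, S a -> a.1 = 0 \/ a.2 = 0 -> a = (0, 0).

Inductive enat : Type := Fin of nat | Infty.

Definition enat_min (x y : enat) : enat :=
  match x, y with
  | Fin a, Fin b => Fin (minn a b)
  | Infty, z | z, Infty => z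
  end.

Definition enat_add (x y : enat) : enat :=
  match x, y with
  | Fin a, Fin b => Fin (a + b)
  | _, _ => Infty
  end.

Definition trop_add : enat * enat -> enat * enat -> enat * enat :=
  pointwise enat_min.
Definition trop_mul : enat * enat -> enat * enat -> enat * enat :=
  pointwise enat_add.
Definition trop_zero : enat * enat := (Infty, Infty).
Definition trop_one : enat * enat := (Fin 0, Fin 0).

Lemma trop_addA : associative trop_add.
Proof.
by move=> [[a|] [a'|]] [[b|] [b'|]] [[c|] [c'|]];
  rewrite /trop_add /pointwise //= ?minnA.
Qed.

Lemma trop_addC : commutative trop_add.
Proof.
move=> [[a|] [a'|]] [[b|] [b'|]]; rewrite /trop_add /pointwise //=;
  by rewrite ?[minn a _]minnC ?[minn a' _]minnC.
Qed.

Lemma trop_add0 : left_id trop_zero trop_add.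
Proof. by move=> [[a|] [b|]]. Qed.

HB.instance Definition _ :=
  Monoid.isComLaw.Build (enat * enat)%type trop_zero trop_add
    trop_addA trop_addC trop_add0.

Lemma trop_mulA : associative trop_mul.
Proof.
by move=> [[a|] [a'|]] [[b|] [b'|]] [[c|] [c'|]];
  rewrite /trop_mul /pointwise //= ?addnA.
Qed.

Lemma trop_mulC : commutative trop_mul.
Proof.
move=> [[a|] [a'|]] [[b|] [b'|]]; rewrite /trop_mul /pointwise //=;
  by rewrite ?[a + _]addnC ?[a' + _]addnC.
Qed.

Lemma trop_mul1 : left_id trop_one trop_mul.
Proof. by move=> [[a|] [b|]]. Qed.

HB.instance Definition _ :=
  Monoid.isComLaw.Build (enat * enat)%type trop_one trop_mul
    trop_mulA trop_mulC trop_mul1.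

Definition fin_pair (a : nat * nat) : enat * enat := (Fin a.1, Fin a.2).

Definition S1_infty (S : set (nat * nat)) : set (enat * enat) :=
  [set (Fin a, Infty) | a in
    [set a | exists y0, forall y, y0 <= y -> S (a, y)]].

Definition S2_infty (S : set (nat * nat)) : set (enat * enat) :=
  [set (Infty, Fin b) | b in
    [set b | exists x0, forall x, x0 <= x -> S (x, b)]].

Definition S_infty (S : set (nat * nat)) : set (enat * enat) :=
  S1_infty S `|` S2_infty S `|` [set (Infty, Infty)].

Definition Gamma (S : set (nat * nat)) : set (enat * enat) :=
  fin_pair @` S `|` S_infty S.

(* [trop_one] is the zero vector (0, 0), the additive identity of N^2. *)
Definition irreducible (S : set (nat * nat)) (x : enat * enat) : Prop :=
  [/\ Gamma S x, x <> trop_one &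
    forall y z, Gamma S y -> Gamma S z -> x = trop_mul y z ->
      x = y \/ x = z].

Definition absolute (S : set (nat * nat)) (x : enat * enat) : Prop :=
  S_infty S x \/
  exists a, [/\ S a, x = fin_pair a &
    ~ exists2 b, S b & (b.1 = a.1 /\ a.2 < b.2) \/ (b.2 = a.2 /\ a.1 < b.1)].

Definition irreducible_absolute (S : set (nat * nat)) : set (enat * enat) :=
  [set x | irreducible S x /\ absolute S x].

(* Main.v *)
(* Every vertical line that meets Gamma_S has a highest point in Gamma_S (it may
   be infinite), and (G3) makes it absolute; the same holds for horizontal lines.
   A finite alpha is the minimum of the highest point of its vertical line and
   the rightmost point of its horizontal line. If an absolute element with finite
   first coordinate is a sum y + z, then replacing y and z by the highest points
   of their vertical lines does not change the sum; by locality both have smaller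
   first coordinate, so by induction the element is a product of irreducible
   absolute ones. Symmetrically for a finite second coordinate, and (oo, oo) is
   the sum of some (a, oo) and (oo, b). *)
Require Import Defs.
From mathcomp Require Import all_boot boolp classical_sets.

Set Implicit Arguments.
Unset Strict Implicit.
Unset Printing Implicit Defensive.

(** * Coordinates, with vertical and horizontal lines treated together *)

Definition cpair (T : Type) (i : bool) (u v : T) : T * T :=
  if i then (v, u) else (u, v).

Lemma coord_cpair (T : Type) i (u v : T) : coord i (cpair i u v) = u.
Proof. by case: i. Qed.

Lemma coordN_cpair (T : Type) i (u v : T) : coord (~~ i) (cpair i u v) = v.
Proof. by case: i. Qed.

Lemma coord_pointwise (T : Type) (op : T -> T -> T) i a b :
  coord i (pointwise op a b) = op (coord i a) (coord i b).
Proof. by case: i. Qed.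

Lemma coord_fin_pair i a : coord i (fin_pair a) = Fin (coord i a).
Proof. by case: i. Qed.

Lemma coord_ext (T : Type) i (a b : T * T) :
  coord i a = coord i b -> coord (~~ i) a = coord (~~ i) b -> a = b.
Proof. by case: a b i => [a1 a2] [b1 b2] [] /= -> ->. Qed.

Lemma fin_pair_inj : injective fin_pair.
Proof. by move=> [a1 a2] [b1 b2] [-> ->]. Qed.

(** * Lines meeting [Gamma S] and their absolute elements *)

Section Line.
Variables (S : set (nat * nat)) (HS : good_semigroup S).

Lemma S_infty_cpair i a :
  (exists y0, forall y, y0 <= y -> S (cpair i a y)) ->
  S_infty S (cpair i (Fin a) Infty).
Proof. by case: i => Ha; left; [right|left]; exists a. Qed.

Lemma Gamma_coord_fin i x a : Gamma S x -> coord i x = Fin a ->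
  (exists2 s, S s & x = fin_pair s) \/
  x = cpair i (Fin a) Infty /\ exists y0, forall y, y0 <= y -> S (cpair i a y).
Proof.
case=> [[s Ss <-] _|]; first by left; exists s.
by case=> [[[b Hb <-]|[b Hb <-]]|->]; case: i => //= -[<-]; right.
Qed.

(** Trades an infinite coordinate for a finite one beyond any bound [n], so that facts about [S] can
    be applied to points at infinity. *)
Lemma Gamma_approx n i x a : Gamma S x -> coord i x = Fin a ->
  exists s, [/\ S s, coord i s = a &
    coord (~~ i) x = Fin (coord (~~ i) s) \/
    coord (~~ i) x = Infty /\ n <= coord (~~ i) s].
Proof.
move=> Gx xa; case: (Gamma_coord_fin Gx xa) => [[s Ss def_x]|[-> [y0 Hy0]]].
  exists s; move: xa; rewrite def_x !coord_fin_pair => -[sa].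
  by split=> //; left.
exists (cpair i a (maxn y0 n)); rewrite coord_cpair !coordN_cpair.
by split; [apply: Hy0; exact: leq_maxl | | right; rewrite leq_maxr].
Qed.

Lemma absolute_Gamma x : absolute S x -> Gamma S x.
Proof. by case=> [|[a [Sa -> _]]]; [right | left; exists a]. Qed.

Lemma absolute_max i a b : absolute S (fin_pair a) -> S b ->
  coord i b = coord i a -> coord (~~ i) b <= coord (~~ i) a.
Proof.
case=> [[[[? _ //]|[? _ //]]|//]|[a' [_ /fin_pair_inj <- Na]] Sb bi].
rewrite leqNgt; apply/negP => lt_ab; apply: Na; exists b => //.
by case: i bi lt_ab; [right|left].
Qed.

Lemma max_absolute i a : S a ->
  (forall b, S b -> coord i b = coord i a ->
     coord (~~ i) b <= coord (~~ i) a) ->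
  absolute S (fin_pair a).
Proof.
move=> Sa maxa; right; exists a; split=> // -[b Sb Hb].
have maxP j : coord j b = coord j a -> coord (~~ j) a < coord (~~ j) b -> False.
  move=> bj ltab; have [ji|ji] := eqVneq j i.
    by move: bj ltab; rewrite ji ltnNge => bj; rewrite (maxa _ Sb bj).
  (* If [b] lies beyond [a] in direction [i], (G3) yields an element beyond [a]
     in direction [~~ i], against [maxa]. *)
  have jE : j = ~~ i by case: i j ji {maxa bj ltab} => [] [].
  have ab : a <> b by move=> ab; rewrite ab ltnn in ltab.
  have [e [Se ltae _ eE]] := good_exchange HS Sa Sb ab (esym bj).
  move: ltab ltae eE; rewrite jE negbK => ltab ltae eE.
  have: coord i e = coord i a.
    rewrite eE; first by rewrite (minn_idPl (ltnW ltab)).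
    by move=> E; rewrite E ltnn in ltab.
  by move=> ei; rewrite ltnNge (maxa _ Se ei) in ltae.
by case: Hb => -[]; [apply: (maxP false) | apply: (maxP true)].
Qed.

(** Once [y] is past the conductor, the point with coordinates [coord i d + a] and [y] is in [S].
    Its minimum with an element of the line at height at least [y] is the point of the line at
    height exactly [y]. *)
Lemma unbounded_S_infty i a :
  (forall n, exists s, [/\ S s, coord i s = a & n <= coord (~~ i) s]) ->
  S_infty S (cpair i (Fin a) Infty).
Proof.
move=> unb; apply: S_infty_cpair; have [d Hd] := good_conductor HS.
exists (coord (~~ i) d) => y led; have [s [Ss sa les]] := unb y.
have SD : S (cpair i (coord i d + a) y).
  have := Hd (cpair i a (y - coord (~~ i) d)); congr (S _).
  by apply: (@coord_ext _ i); rewrite coord_pointwise ?coord_cpair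
    ?coordN_cpair // subnKC.
have := good_min HS SD Ss; congr (S _); apply: (@coord_ext _ i);
  rewrite coord_pointwise ?coord_cpair ?coordN_cpair.
  by rewrite sa; apply/minn_idPr; rewrite leq_addl.
exact/minn_idPl.
Qed.

(** Here [y] is the top of the line through [x]: its end at infinity, or its maximum when the line
    is bounded. The last clause is the order relation between the other coordinates, expressed by
    [enat_min]. *)
Lemma absolute_completion i x a : Gamma S x -> coord i x = Fin a ->
  exists y, [/\ absolute S y, coord i y = Fin a &
    enat_min (coord (~~ i) x) (coord (~~ i) y) = coord (~~ i) x].
Proof.
move=> Gx xa; case: (Gamma_coord_fin Gx xa) 
  => [[s Ss def_x]|[-> Hy0]]; last first.
  exists (cpair i (Fin a) Infty); rewrite coord_cpair coordN_cpair.
  by split=> //; left; exact: S_infty_cpair.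
move: xa; rewrite def_x !coord_fin_pair => -[sa].
have [unb|/existsNP [N HN]] := pselect
    (forall n, exists s, [/\ S s, coord i s = a & n <= coord (~~ i) s]).
  exists (cpair i (Fin a) Infty); rewrite coord_cpair coordN_cpair.
  by split=> //; left; exact: unbounded_S_infty.
pose P n := `[< exists t, [/\ S t, coord i t = a & coord (~~ i) t = n] >].
have exP : exists n, P n by exists (coord (~~ i) s); apply/asboolP; exists s.
have ubP n : P n -> n <= N.
  move=> /asboolP [t [St ta <-]]; rewrite leqNgt; apply/negP => /ltnW ltN.
  by apply: HN; exists t.
case: (ex_maxnP exP ubP) => m /asboolP [t [St ta tm]] maxm.
exists (fin_pair t); rewrite !coord_fin_pair ta; split=> //.
  apply: (@max_absolute i) => // b Sb bt; rewrite tm.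
  by apply: maxm; apply/asboolP; exists b; rewrite bt.
congr Fin; apply/minn_idPl; rewrite tm; apply: maxm.
by apply/asboolP; exists s.
Qed.

(** The new sum lies on the line of [x] and is no lower than [x]; as [x] is absolute, it is no
    higher either. *)
Lemma absolute_mul_completion i x y z y' z' a b :
  absolute S x -> x = trop_mul y z ->
  coord i y = Fin a -> coord i z = Fin b ->
  absolute S y' -> coord i y' = Fin a ->
  enat_min (coord (~~ i) y) (coord (~~ i) y') = coord (~~ i) y ->
  absolute S z' -> coord i z' = Fin b ->
  enat_min (coord (~~ i) z) (coord (~~ i) z') = coord (~~ i) z ->
  x = trop_mul y' z'.
Proof.
move=> Ax def_x ya zb Ay' y'a ley Az' z'b lez.
have xab : coord i x = Fin (a + b).
  by rewrite def_x coord_pointwise ya zb.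
apply: (@coord_ext _ i); first by rewrite coord_pointwise xab y'a z'b.
have xN : coord (~~ i) x = enat_add (coord (~~ i) y) (coord (~~ i) z).
  by rewrite def_x coord_pointwise.
rewrite coord_pointwise.
(* If [x] is at infinity, then so is [y] or [z], hence also [y'] or [z']. *)
case: (Gamma_coord_fin (absolute_Gamma Ax) xab) => [[s Ss xs]|[xs _]]; last first.
  move: xN ley lez; rewrite xs coordN_cpair.
  case: (coord _ y) (coord _ z) (coord _ y') (coord _ z')
    => [?|] [?|] [?|] [?|] //.
set v := coord (~~ i) s.
have xv : coord (~~ i) x = Fin v by rewrite xs coord_fin_pair.
have sab : coord i s = a + b by move: xab; rewrite xs coord_fin_pair => -[].
(* The bound [v.+1] excludes an infinite [y'] or [z']: its approximation alone would push [s1 + s2]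
   above [s] on the same line. *)
have [s1 [Ss1 s1a Hs1]] := Gamma_approx v.+1 (absolute_Gamma Ay') y'a.
have [s2 [Ss2 s2b Hs2]] := Gamma_approx v.+1 (absolute_Gamma Az') z'b.
have := absolute_max (i := i) (b := pointwise addn s1 s2).
move=> /(_ s); rewrite -xs => /(_ Ax (good_add HS Ss1 Ss2)).
rewrite !coord_pointwise s1a s2b -/v => /(_ (esym sab)) le12.
case: Hs1 => [y'E|[_ lt1]]; last first.
  by have := leq_trans lt1 (leq_trans (leq_addr _ _) le12); rewrite ltnn.
case: Hs2 => [z'E|[_ lt2]]; last first.
  by have := leq_trans lt2 (leq_trans (leq_addl _ _) le12); rewrite ltnn.
rewrite xv in xN *; move: xN ley lez; rewrite y'E z'E.
case: (coord _ y) (coord _ z) => [p|] [q|] //= -[vE] [lep] [leq'].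
congr Fin; apply/eqP; rewrite eqn_leq le12 andbT vE.
by apply: leq_add; apply/minn_idPl.
Qed.

End Line.

(** * Finite products and sums of products *)

Definition is_product (A : set (enat * enat)) (x : enat * enat) : Prop :=
  exists n (g : 'I_n -> enat * enat),
    [/\ 0 < n, forall j, A (g j) & x = \big[trop_mul/trop_one]_(j < n) g j].

Lemma is_product1 (A : set (enat * enat)) x : A x -> is_product A x.
Proof. by move=> Ax; exists 1, (fun=> x); rewrite big_ord1. Qed.

Lemma is_productM A x y :
  is_product A x -> is_product A y -> is_product A (trop_mul x y).
Proof.
move=> [n [g [n0 Ag ->]]] [m [h [m0 Ah ->]]].
exists (n + m), (fun j => match split j with inl k => g k | inr k => h k end).
split; first by rewrite addn_gt0 n0.
  by move=> j; case: (split j).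
rewrite big_split_ord /=; congr trop_mul; apply: eq_bigr => j _.
  by rewrite (unsplitK (inl j)).
by rewrite (unsplitK (inr j)).
Qed.

Lemma sum_of_products A m (p : 'I_m -> enat * enat) :
  (forall i, is_product A (p i)) ->
  exists (n : 'I_m -> nat) (gamma : forall i : 'I_m, 'I_(n i) -> enat * enat),
    [/\ forall i, 0 < n i, forall i j, A (gamma i j) &
      \big[trop_add/trop_zero]_(i < m) p i =
      \big[trop_add/trop_zero]_(i < m)
        \big[trop_mul/trop_one]_(j < n i) gamma i j].
Proof.
move=> Hp.
(* The length and the factors are chosen together as a dependent pair, because the index type of the
   factors depends on the length. *)
have /choice [f Hf] : forall i, exists u : {n & 'I_n -> enat * enat},
    [/\ 0 < tag u, forall j, A (tagged u j) &
      p i = \big[trop_mul/trop_one]_(j < tag u) tagged u j].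
  by move=> i; have [n [g Hg]] := Hp i; exists (existT _ n g).
exists (fun i => tag (f i)), (fun i => tagged (f i)).
split; [by move=> i; case: (Hf i) | by move=> i; case: (Hf i) |].
by apply: eq_bigr => i _; case: (Hf i).
Qed.

(** * Factorization under locality *)

Section Local.
Variables (S : set (nat * nat)) (HS : good_semigroup S) (HSlocal : local S).

Lemma Gamma_coord0 i x : Gamma S x -> coord i x = Fin 0 -> x = trop_one.
Proof.
(* With bound 1, an infinite other coordinate would give an element of [S] with one coordinate zero
   and the other positive, against locality. *)
move=> Gx x0; have [s [Ss s0 Hs]] := Gamma_approx 1 Gx x0.
have sE : s = (0, 0) by apply: HSlocal => //; case: i s0 {x0 Hs}; [right|left].
apply: (@coord_ext _ i); first by rewrite x0; case: i {x0 s0 Hs}.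
by move: Hs; rewrite sE; case: i {x0 s0} => -[->|[]].
Qed.

Lemma absolute_product i x a : absolute S x -> x <> trop_one ->
  coord i x = Fin a -> is_product (irreducible_absolute S) x.
Proof.
elim/ltn_ind: a x => a IH x Ax x1 xa.
have [Ix|NIx] := pselect (irreducible S x); first exact: is_product1.
have [y [z [Gy Gz xyz xy xz]]] : exists y z,
    [/\ Gamma S y, Gamma S z, x = trop_mul y z, x <> y & x <> z].
  apply: contrapT => N; apply: NIx; split=> //; first exact: absolute_Gamma.
  move=> y z Gy Gz xyz; apply: contrapT => /not_orP [xy xz].
  by apply: N; exists y, z.
have y1 : y <> trop_one by move=> E; apply: xz; rewrite xyz E trop_mul1.
have z1 : z <> trop_one.
  by move=> E; apply: xy; rewrite xyz E trop_mulC trop_mul1.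
have: enat_add (coord i y) (coord i z) = Fin a.
  by rewrite -xa xyz coord_pointwise.
case yb: (coord i y) => [b|//]; case zc: (coord i z) => [c|//] [abc].
(* A zero coordinate would make [y] or [z] equal to [trop_one]. With both positive, [b] and [c] are
   smaller than [a]. *)
have b0 : 0 < b.
  by rewrite lt0n; apply/eqP => E; apply: y1;
    apply: (@Gamma_coord0 i); rewrite ?yb ?E.
have c0 : 0 < c.
  by rewrite lt0n; apply/eqP => E; apply: z1;
    apply: (@Gamma_coord0 i); rewrite ?zc ?E.
(* The induction hypothesis covers only absolute elements, which [y] and [z] need not be. *)
have [y' [Ay' y'b ley]] := absolute_completion HS Gy yb.
have [z' [Az' z'c lez]] := absolute_completion HS Gz zc.
rewrite (absolute_mul_completion HS Ax xyz yb zc Ay' y'b ley Az' z'c lez).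
have neq1 w k : 0 < k -> coord i w = Fin k -> w <> trop_one.
  by move=> k0 wk w1; move: wk k0; rewrite w1; case: (i) => -[<-].
apply: is_productM.
  by apply: (IH b) => //; [rewrite -abc -addn1 leq_add2l | exact: neq1 y'b].
by apply: (IH c) => //; [rewrite -abc -add1n leq_add2r | exact: neq1 z'c].
Qed.

Lemma S_infty_product x : S_infty S x -> is_product (irreducible_absolute S) x.
Proof.
have prod i a : S_infty S (cpair i (Fin a) Infty) ->
    is_product (irreducible_absolute S) (cpair i (Fin a) Infty).
  move=> Ix; apply: (@absolute_product i _ a); [by left | by case: (i) |].
  by rewrite coord_cpair.
case=> [[[a Ha <-]|[b Hb <-]]|->].
- by apply: (prod false); left; left; exists a.
- by apply: (prod true); left; right; exists b.
(* No finite coordinate is left to induct on. The two lines through the conductor [d] are eventually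
   contained in [S], and their ends at infinity add up to this point. *)
have [d Hd] := good_conductor HS.
have -> : (Infty, Infty) = trop_mul (Fin d.1, Infty) (Infty, Fin d.2) by [].
apply: is_productM.
  apply: (prod false); left; left; exists d.1 => //.
  exists d.2 => y ley; have := Hd (0, y - d.2).
  by rewrite /pointwise /= addn0 subnKC.
apply: (prod true); left; right; exists d.2 => //.
exists d.1 => y ley; have := Hd (y - d.1, 0).
by rewrite /pointwise /= addn0 subnKC.
Qed.

Lemma finite_min_products s : S s -> s <> (0, 0) ->
  exists x y, [/\ is_product (irreducible_absolute S) x,
    is_product (irreducible_absolute S) y & fin_pair s = trop_add x y].
Proof.
move=> Ss s0; have Gs : Gamma S (fin_pair s) by left; exists s.
have s1 : fin_pair s <> trop_one by move=> /(@fin_pair_inj s (0, 0)).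
(* A completion shares a coordinate with [s]; were it [trop_one], that coordinate would be zero and
   locality would force [s] to be zero. *)
have neq1 i w : Gamma S w -> coord i w = Fin (coord i s) -> w <> trop_one.
  move=> Gw ws w1; apply: s1; apply: (@Gamma_coord0 i) => //.
  by rewrite coord_fin_pair -ws w1; case: (i).
have [x [Ax xs lex]] := absolute_completion (i := false) HS Gs erefl.
have [y [Ay ys ley]] := absolute_completion (i := true) HS Gs erefl.
exists x, y; split.
- by apply: (absolute_product Ax _ xs); apply: neq1 xs; exact: absolute_Gamma.
- by apply: (absolute_product Ay _ ys); apply: neq1 ys; exact: absolute_Gamma.
(* Each completion keeps one coordinate of [s] and dominates the other, so the minimum is [s]. *)
case: x y xs ys lex ley {Ax Ay} => [x1 x2] [y1 y2] /= -> -> lex ley.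
rewrite /trop_add /pointwise /=; congr pair; first by rewrite -[LHS]ley.
by rewrite -[LHS]lex; case: (x2) => //= n; rewrite minnC.
Qed.

End Local.

Theorem theorem10 (S : set (nat * nat)) (HS : good_semigroup S)
    (HSlocal : local S) (alpha : enat * enat) (Halpha : Gamma S alpha)
    (Halpha0 : alpha <> (Fin 0, Fin 0)) :
  exists (m : nat) (n : 'I_m -> nat)
         (gamma : forall i : 'I_m, 'I_(n i) -> enat * enat),
    [/\ 0 < m,
        forall i, 0 < n i,
        forall i j, irreducible_absolute S (gamma i j) &
        alpha = \big[trop_add/trop_zero]_(i < m)
                  \big[trop_mul/trop_one]_(j < n i) gamma i j].
Proof.
suff [m [p [m0 Hp ->]]] : exists m (p : 'I_m -> enat * enat),
    [/\ 0 < m, forall i, is_product (irreducible_absolute S) (p i) &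
      alpha = \big[trop_add/trop_zero]_(i < m) p i].
  by have [n [g [n0 Ag E]]] := sum_of_products Hp; exists m, n, g.
case: Halpha Halpha0 => [[s Ss <-] s1|Ia _]; last first.
  exists 1, (fun=> alpha); rewrite big_ord1; split=> // _.
  exact: S_infty_product.
have [x [y [Px Py ->]]] : exists x y,
    [/\ is_product (irreducible_absolute S) x,
      is_product (irreducible_absolute S) y & fin_pair s = trop_add x y].
  by apply: finite_min_products => // s0; apply: s1; rewrite s0.
exists 2, (fun i => if i == ord0 then x else y).
by split; [| move=> i; case: ifP | rewrite big_ord_recl big_ord1].
Qed.
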